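(* Consider the Markov-modeled downlink with randomly delayed ARQ feedback described in the context (with $p>r$). When $N=2$, the sum capacity of this downlink equals that of the genie-aided system, i.e. $C_{\mathrm{sum}}(2)=C_{\mathrm{sum}}^{\mathrm{genie}}(2)$. This sum capacity equals $$C_{\mathrm{sum}}(2)=\sum_{l=0}^{\infty}\Big[p_sT^l(p)+(1-p_s)p_s\Big]\,P(D\le l)\prod_{d=0}^{l-1}P(D>d),$$ where $p_s=\frac{r}{1-(p-r)}$ and an empty product equals $1$. Furthermore, the greedy policy achieves this sum capacity.
   Context: Model. There are $N$ users. Time is slotted and slots are indexed in DEcreasing order $m,m-1,\ldots,1$, where $m$ is the horizon (slot $m$ is first, slot $1$ is last). The channel state of user $i$ in slot $t$ is $S_t(i)\in\{0,1\}$ ($1$ = ON, $0$ = OFF). The channels are independent across users, and each is a Markov chain with $P(S_t(i)=1\mid S_{t+1}(i)=1)=p$ and $P(S_t(i)=1\mid S_{t+1}(i)=0)=r$, with $p,r\in[0,1]$, $p>r$ and $p+(1-r)<2$. Initially $P(S_m(i)=1)=\pi_m(i)$. The stationary ON probability is $p_s=\frac{r}{1-(p-r)}$. Scheduling and feedback. In each slot $t$ the scheduler, not knowing the channel states, schedules exactly one user $a_t\in\{1,\ldots,N\}$. The scheduled user generates the ARQ feedback bit $f_t=S_t(a_t)$, which arrives, without error and stamped with its originating slot, at the end of slot $t-D(a_t,t)$ (delay $0$ means it arrives at the end of slot $t$ itself). The delays $D(i,t)$ are i.i.d. across users and time with probability mass function $P_D$ on $\{0,1,2,\ldots\}$ and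 independent of the channels; $D$ denotes a generic delay with this law. Beliefs. Let $T(x)=xp+(1-x)r$, $T^0(x)=x$, $T^u=T\circ T^{u-1}$. The belief $\pi_t(i)$ is the conditional probability that user $i$'s channel is ON in slot $t$ given all feedback that has arrived by the beginning of slot $t$. Policies and reward. A scheduling policy is a family of maps $\{\mathfrak{A}_k\}_{k\ge1}$, where $\mathfrak{A}_k$ maps all the information available to the scheduler in slot $k$ (time-stamped feedback arrived so far, equivalently the current beliefs for slots $m,\ldots,k$, and past decisions) to a decision $a_k$. The reward in slot $t$ is $\pi_t(a_t)$ and $V_m(\pi_m,\{\mathfrak{A}_k\})=E\big[\sum_{t=1}^m\pi_t(a_t)\big]$ is the expected total reward with initial belief $\pi_m$. The greedy policy schedules $\arg\max_i\pi_k(i)$ in each slot $k$. Sum capacity. $C_{\mathrm{sum}}(N)=\max_{\{\mathfrak{A}_k\}_{k\ge1}}\lim_{m\to\infty}\frac{V_m(\pi_{ss},\{\mathfrak{A}_k\}_{k\ge1})}{m}$, where $\pi_{ss}(i)=p_s$ for all $i$. Genie-aided system. The same system, except that the feedback $f_k$ originating in slot $k$ consists of the channel states in slot $k$ of all $N$ users, $(S_k(1),\ldots,S_k(N))$; this cumulative feedback arrives together with delay $D(a_k,k)$. $C_{\mathrm{sum}}^{\mathrm{genie}}(N)$ is its sum capacity, defined in the same way. *)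

(* Defs.v *)
(* MathComp-Analysis *)
From mathcomp Require Export all_boot all_order all_algebra.
From mathcomp Require Export all_classical all_reals all_analysis.
Export Order.TTheory GRing.Theory Num.Theory.
Export numFieldNormedType.Exports.

#[export] Set Implicit Arguments.
#[export] Unset Strict Implicit.
#[export] Unset Printing Implicit Defensive.

#[global] Open Scope classical_set_scope.
#[global] Open Scope ring_scope.

(** * Discrete probability

    A nonnegative mass function [mu] on a (countable) type; [pr] and [ex] are
    used below only for mass functions of total mass 1 and for nonnegative
    [X]. *)

Definition is_pmf (R : realType) (T : choiceType) (mu : T -> R) : Prop :=
  (forall x, 0 <= mu x) /\ (\esum_(x in [set: T]) (mu x)%:E = 1)%E.

Definition pr (R : realType) (T : choiceType) (mu : T -> R) (A : set T) : R :=
  fine (\esum_(x in A) (mu x)%:E).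

Definition cond_pr (R : realType) (T : choiceType) (mu : T -> R)
    (A B : set T) : R := pr mu (A `&` B) / pr mu B.

Definition ex (R : realType) (T : choiceType) (mu : T -> R) (X : T -> R) : R :=
  fine (\esum_(x in [set: T]) (mu x * X x)%:E).

(** * Channels and delays over a horizon of [m] slots *)

(* The ordinal [j : 'I_m] stands for slot [j.+1]: slot m comes first in time
   and slot 1 last.  The first component holds the channel states (true = ON),
   the second one the delays D(i,t). *)
Definition outcome (N m : nat) : choiceType :=
  ({ffun 'I_m -> {ffun 'I_N -> bool}} * {ffun 'I_m -> {ffun 'I_N -> nat}})%type.

(* [state w t i] is S_t(i) and [delay w t i] is D(i,t), for 1 <= t <= m; other
   values of [t] are never used. *)
Definition state (N m : nat) (w : outcome N m) (t : nat) : {ffun 'I_N -> bool} :=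
  oapp w.1 [ffun=> false] (insub t.-1).

Definition delay (N m : nat) (w : outcome N m) (t : nat) : {ffun 'I_N -> nat} :=
  oapp w.2 [ffun=> 0%N] (insub t.-1).

Record downlink (R : realType) := Downlink {
  pON : R;          (* P(S_t(i) = 1 | S_{t+1}(i) = 1) *)
  rON : R;          (* P(S_t(i) = 1 | S_{t+1}(i) = 0) *)
  pD : nat -> R     (* mass function of the delays *)
}.

(* Joint law: independent Markov channels, with initial ON probabilities
   [pi i] in slot m, and i.i.d. delays independent of the channels. *)
Definition law (R : realType) (M : downlink R) (N : nat) (pi : 'I_N -> R)
    (m : nat) (w : outcome N m) : R :=
  (\prod_(i < N) \prod_(1 <= t < m.+1)
     bernoulli_pmf (if t == m then pi i
                    else if state w t.+1 i then pON M else rON M)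
                   (state w t i))
  * \prod_(1 <= t < m.+1) \prod_(i < N) pD M (delay w t i).

(** * Feedback, information and policies *)

(* The feedback originating in a slot is a function of the scheduled user and
   of the channel states in that slot. *)
Record feedback (N : nat) := Feedback {
  fb_type : Type;
  fb_map : 'I_N -> {ffun 'I_N -> bool} -> fb_type
}.

Definition arq (N : nat) : feedback N := Feedback (fun a s => s a).
Definition genie (N : nat) : feedback N := Feedback (fun a s => s).

(* An entry [((t, a), o)] records a past slot [t], the user [a] scheduled in
   it, and [o], which is [None] as long as the feedback from slot [t] has not
   arrived, and [Some (f, d)] once the feedback [f] has arrived with delay
   [d] (that is, at the end of slot t - d). *)
Definition history (N : nat) (F : feedback N) : Type :=
  seq ((nat * 'I_N) * option (fb_type F * nat)).

(* The history presented in slot [k] has one entry for each of the slots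
   m, ..., k+1, in this order. *)
Definition policy (N : nat) (F : feedback N) : Type :=
  nat -> history F -> 'I_N.

(* Feedback arriving at the end of slot t - d is available in slot [k] if and
   only if k + 1 <= t - d. *)
Definition observe (N : nat) (F : feedback N) (m : nat) (w : outcome N m)
    (k : nat) (past : seq (nat * 'I_N)) : history F :=
  [seq (x, if (delay w x.1 x.2 + k < x.1)%N
           then Some (fb_map F x.2 (state w x.1), delay w x.1 x.2)
           else None) | x <- past].

(* The decisions taken by [A] in the first [j] slots m, ..., m-j+1. *)
Fixpoint schedule (N : nat) (F : feedback N) (A : policy F) (m : nat)
    (w : outcome N m) (j : nat) : seq (nat * 'I_N) :=
  if j is j'.+1 then
    let past := schedule A w j' in
    rcons past ((m - j')%N, A (m - j')%N (observe F w (m - j')%N past))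
  else [::].

Definition info (N : nat) (F : feedback N) (A : policy F) (m : nat)
    (w : outcome N m) (k : nat) : history F :=
  observe F w k (schedule A w (m - k)%N).

Definition decision (N : nat) (F : feedback N) (A : policy F) (m : nat)
    (w : outcome N m) (k : nat) : 'I_N := A k (info A w k).

(** * Beliefs, reward and sum capacity *)

(* pi_k(i), as a random variable. *)
Definition belief (R : realType) (M : downlink R) (N : nat) (F : feedback N)
    (A : policy F) (pi : 'I_N -> R) (m k : nat) (i : 'I_N)
    (w : outcome N m) : R :=
  cond_pr (law M pi (m := m)) [set w' | state w' k i]
          [set w' | info A w' k = info A w k].

(* V_m(pi, A) *)
Definition value (R : realType) (M : downlink R) (N : nat) (F : feedback N)
    (A : policy F) (pi : 'I_N -> R) (m : nat) : R :=
  ex (law M pi (m := m))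
     (fun w => \sum_(1 <= t < m.+1) belief M A pi t (decision A w t) w).

Definition greedy (R : realType) (M : downlink R) (N : nat) (F : feedback N)
    (A : policy F) (pi : 'I_N -> R) : Prop :=
  forall (m k : nat) (w : outcome N m), (1 <= k <= m)%N ->
  forall i, belief M A pi k i w <= belief M A pi k (decision A w k) w.

Definition p_s (R : realType) (M : downlink R) : R :=
  rON M / (1 - (pON M - rON M)).

Definition pi_ss (R : realType) (M : downlink R) (N : nat) : 'I_N -> R :=
  fun=> p_s M.

Definition has_rate (R : realType) (M : downlink R) (N : nat) (F : feedback N)
    (A : policy F) (c : R) : Prop :=
  (fun m : nat => value M A (pi_ss M (N := N)) m / m%:R) @ \oo --> c.

(* The maximum is over the policies for which the limit exists. *)
Definition is_sum_capacity (R : realType) (M : downlink R) (N : nat)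
    (F : feedback N) (c : R) : Prop :=
  let rates := [set c' | exists A : policy F, has_rate M A c'] in
  rates c /\ ubound rates c.

Definition Tmap (R : realType) (M : downlink R) (x : R) : R :=
  x * pON M + (1 - x) * rON M.

(* Main.v *)
Require Import Defs.
From mathcomp Require Import zify ring lra.

(** Fix a slot [t] and let [s+1 > t] be the latest slot whose feedback is
    available in slot [t].  On this event everything observed so far, hence also
    the decision in slot [t], depends on the channels only through the slots
    before and including [s+1]; by the Markov property the expected reward of
    scheduling user [i] is the mean of [T^(s+1-t)] applied to the state of [i] in
    slot [s+1].  It is at most [T^(s+1-t)] of "some user was ON in slot [s+1]",
    whose mean does not depend on the policy, because delays are i.i.d. and
    independent of the channels.  With two users and ARQ feedback the bound is
    attained by staying with the user of that feedback if it was ON and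
    switching otherwise.  The greedy policy maximizes the belief in every slot, so
    it does at least as well as this rule.  The expected reward of a slot
    converges as its distance to the first slot grows, and Cesaro's theorem
    gives the rate. *)

(** * Sums over finite families *)

Lemma esumZl (R : realType) (T : choiceType) (A : set T) (a : T -> \bar R)
    (r : R) : (0 <= r)%R -> (forall x, 0 <= a x)%E ->
  (\esum_(x in A) (r%:E * a x) = r%:E * \esum_(x in A) a x)%E.
Proof.
move=> r0 a0; rewrite /esum -ereal_supZl//; last first.
  apply/set0P; exists (\sum_(x \in set0) a x)%E.
  by exists set0 => //; exact: fsets_set0.
congr ereal_sup; apply/seteqP.
split=> [_ [X [fX XA] <-]|_ [_ [X [fX XA] <-] <-]].
  by exists (\sum_(x \in X) a x)%E; [exists X|rewrite ge0_mule_fsumr].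
by exists X; rewrite // ge0_mule_fsumr.
Qed.

(** Coordinates outside [s] are frozen to [f0], so that induction on [s] releases one coordinate at
    a time. *)
Lemma esum_finfun_seq (R : realType) (I : finType) (T : choiceType)
    (F : I -> T -> R) (A : I -> set T) (a : I -> R) (s : seq I)
    (f0 : {ffun I -> T}) :
  (forall i x, 0 <= F i x) ->
  (forall i, \esum_(x in A i) (F i x)%:E = (a i)%:E)%E -> uniq s ->
  (\esum_(f in [set f : {ffun I -> T} |
                 forall i, if i \in s then A i (f i) else f i = f0 i])
     (\prod_(i <- s) F i (f i))%:E = (\prod_(i <- s) a i)%:E)%E.
Proof.
move=> F0 Fa; have a0 i : 0 <= a i.
  by rewrite -lee_fin -Fa esum_ge0// => x _; rewrite lee_fin.
elim: s f0 => [|j s IHs] f0 /=.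
  move=> _; rewrite big_nil.
  rewrite (_ : [set f | _] = [set f0]).
    by rewrite esum_set1 ?big_nil// lee_fin.
  apply/seteqP; split=> f /=; last by move=> ->.
  by move=> ff0; apply/ffunP => i; exact: ff0.
case/andP=> js us.
pose upd x : {ffun I -> T} := [ffun i => if i == j then x else f0 i].
pose S x := [set f : {ffun I -> T} |
               forall i, if i \in s then A i (f i) else f i = upd x i].
rewrite big_cons EFinM.
transitivity (\esum_(x in A j) \esum_(f in S x)
   ((F j x)%:E * (\prod_(i <- s) F i (f i))%:E))%E; last first.
  under eq_esum => x _.
    rewrite esumZl// ?IHs//; last by move=> f; rewrite lee_fin prodr_ge0.
    rewrite muleC; over.
  by rewrite esumZl ?Fa ?prodr_ge0// => [|x]; rewrite ?lee_fin// muleC.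
rewrite esum_esum; last first.
  by move=> x f _ _; rewrite -EFinM lee_fin mulr_ge0// prodr_ge0.
rewrite (@reindex_esum _ _ _ (A j `*`` S) _ snd).
  apply: eq_esum => -[x f] [/= Ax Sf]; rewrite big_cons EFinM.
  by have := Sf j; rewrite (negbTE js) ffunE eqxx => ->.
split.
- move=> [x f] [/= Ax Sf] i; have := Sf i.
  rewrite in_cons ffunE; case: eqP => [->|_]//=.
  by rewrite (negbTE js) => ->.
- move=> [x f] [x' f']; rewrite !inE => -[/= Ax Sf] [/= Ax' Sf'] ff'.
  rewrite -ff' in Sf' *; congr (_, _).
  have := Sf j; have := Sf' j.
  by rewrite (negbTE js) !ffunE eqxx => -> ->.
- move=> f /= Hf; exists (f j, f) => //; split => /=.
    by have := Hf j; rewrite mem_head.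
  move=> i; have := Hf i; rewrite in_cons ffunE.
  by case: eqP => [->|]//=; rewrite (negbTE js).
Qed.

Lemma esum_finfun (R : realType) (I : finType) (T : choiceType) (x0 : T)
    (F : I -> T -> R) (A : I -> set T) (a : I -> R) :
  (forall i x, 0 <= F i x) ->
  (forall i, \esum_(x in A i) (F i x)%:E = (a i)%:E)%E ->
  (\esum_(f in [set f : {ffun I -> T} | forall i, A i (f i)])
     (\prod_i F i (f i))%:E = (\prod_i a i)%:E)%E.
Proof.
move=> F0 Fa; rewrite -(esum_finfun_seq [ffun=> x0] F0 Fa (index_enum_uniq I)).
congr esum; apply/seteqP.
by split=> f /= fA i; have := fA i; rewrite mem_index_enum.
Qed.

Lemma esum_fiber (R : realType) (T : choiceType) (J : finType) (g : T -> J)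
    (a : T -> \bar R) : (forall x, 0 <= a x)%E ->
  (\esum_(x in [set: T]) a x = \sum_j \esum_(x in [set x | g x = j]) a x)%E.
Proof.
move=> a0; under [RHS]eq_bigr do rewrite esum_mkcond.
rewrite -esum_sum; last by move=> x j _ _; case: ifP.
apply: eq_esum => x _; rewrite (bigD1 (g x))//= big1 ?adde0 ?mem_set//.
by move=> j jx; rewrite memNset// => /= gx; rewrite gx eqxx in jx.
Qed.

(** * Reduction of expectations to finite sums *)

Section FiniteExpectation.
Variables (R : realType) (M : downlink R) (N : nat) (pi : 'I_N -> R) (m : nat).

(** The channel part of [state], separated from the delays because the two are summed
    independently. *)
Definition slot_states (S : {ffun 'I_m -> {ffun 'I_N -> bool}}) (t : nat) :
    {ffun 'I_N -> bool} := oapp S [ffun=> false] (insub t.-1).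

Definition channel_law (S : {ffun 'I_m -> {ffun 'I_N -> bool}}) : R :=
  \prod_(i < N) \prod_(1 <= t < m.+1)
     bernoulli_pmf (if t == m then pi i
                    else if slot_states S t.+1 i then pON M else rON M)
                   (slot_states S t i).

(* Delays at least [m] are all equivalent over a horizon of [m] slots, which
   reduces every expectation below to a finite sum. *)
Definition clip (d : nat) : 'I_m.+1 := inord (minn d m).

Definition clip_delays (d : {ffun 'I_m -> {ffun 'I_N -> nat}}) :
    {ffun 'I_m -> {ffun 'I_N -> 'I_m.+1}} :=
  [ffun t => [ffun i => clip (d t i)]].

Definition unclip (d : {ffun 'I_m -> {ffun 'I_N -> 'I_m.+1}}) :
    {ffun 'I_m -> {ffun 'I_N -> nat}} :=
  [ffun t => [ffun i => d t i : nat]].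

Definition clip_pmf (j : 'I_m.+1) : R := pr (pD M) [set d | clip d = j].

Definition delay_law (d : {ffun 'I_m -> {ffun 'I_N -> 'I_m.+1}}) : R :=
  \prod_t \prod_i clip_pmf (d t i).

(** Represents the expectation under [law] for functions that do not distinguish delays of at least
    [m]. *)
Definition fin_ex (f : outcome N m -> R) : R :=
  \sum_S \sum_d channel_law S * delay_law d * f (S, unclip d).

Lemma slot_statesE S (k : 'I_m) : slot_states S k.+1 = S k.
Proof. by rewrite /slot_states/= insubT//= => kn; congr (S _); apply: val_inj. Qed.

Lemma lawE (w : outcome N m) :
  law M pi w = channel_law w.1 * \prod_t \prod_i pD M (w.2 t i).
Proof.
congr (_ * _); rewrite big_add1/= big_mkord; apply: eq_bigr => t _.
apply: eq_bigr => i _; congr (pD M (_ i)).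
by rewrite /delay/= insubT//= => kn; congr (w.2 _); apply: val_inj.
Qed.

Hypotheses (hp : 0 <= pON M <= 1) (hr : 0 <= rON M <= 1) (hD : is_pmf (pD M))
  (hpi : forall i, 0 <= pi i <= 1).

Lemma channel_law_ge0 S : 0 <= channel_law S.
Proof.
apply: prodr_ge0 => i _; apply: prodr_ge0 => t _; apply: bernoulli_pmf_ge0.
by case: ifP => // _; case: ifP.
Qed.

Lemma pr_pDE (A : set nat) :
  (\esum_(d in A) (pD M d)%:E = (pr (pD M) A)%:E)%E.
Proof.
have [pD0 pD1] := hD.
rewrite /pr fineK// ge0_fin_numE; last by rewrite esum_ge0// => d _; rewrite lee_fin.
apply: (@le_lt_trans _ _ 1%E); last by rewrite ltry.
rewrite -pD1 esum_mkcond le_esum// => d _.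
by case: ifP => // _; rewrite lee_fin.
Qed.

Lemma pr_pD_ge0 (A : set nat) : 0 <= pr (pD M) A.
Proof.
by rewrite -lee_fin -pr_pDE esum_ge0// => d _; rewrite lee_fin; case: hD.
Qed.

Lemma delay_law_ge0 d : 0 <= delay_law d.
Proof.
by apply: prodr_ge0 => t _; apply: prodr_ge0 => i _; exact: pr_pD_ge0.
Qed.

Lemma law_ge0 (w : outcome N m) : 0 <= law M pi w.
Proof.
rewrite lawE mulr_ge0 ?channel_law_ge0//.
by apply: prodr_ge0 => t _; apply: prodr_ge0 => i _; case: hD.
Qed.

(** Outcomes are grouped by channel states and clipped delays: [f] is constant on each group, and
    the mass of a group factors because the delays are independent. *)
Lemma esum_law (f : outcome N m -> R) : (forall w, 0 <= f w) ->
  (forall S d, f (S, unclip (clip_delays d)) = f (S, d)) ->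
  (\esum_(w in [set: outcome N m]) (law M pi w * f w)%:E = (fin_ex f)%:E)%E.
Proof.
move=> f0 fclip.
pose g (w : outcome N m) := (w.1, clip_delays w.2).
rewrite (esum_fiber g); last by move=> w; rewrite lee_fin mulr_ge0 ?law_ge0.
rewrite /fin_ex pair_bigA/= -sumEFin; apply: eq_bigr => -[S d] _ /=.
pose B (t : 'I_m) := [set x : {ffun 'I_N -> nat} | forall i, clip (x i) = d t i].
rewrite (@reindex_esum _ _ _ [set x : {ffun 'I_m -> {ffun 'I_N -> nat}} |
   forall t, B t (x t)] _ (fun x => (S, x))); last first.
  split.
  - move=> x /= Bx; congr (_, _); apply/ffunP => t; apply/ffunP => i.
    by rewrite !ffunE Bx.
  - by move=> x y _ _ [].
  - move=> [S' x] /= [-> /ffunP xd]; exists x => // t i.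
    by have /ffunP/(_ i) := xd t; rewrite !ffunE.
transitivity (\esum_(x in [set x : {ffun 'I_m -> {ffun 'I_N -> nat}} |
      forall t, B t (x t)])
   ((channel_law S * f (S, unclip d))%:E * (\prod_t \prod_i pD M (x t i))%:E))%E.
  apply: eq_esum => x /= Bx; rewrite lawE/= -EFinM -fclip mulrAC.
  congr (_ * f (_, unclip _) * _)%:E; apply/ffunP => t; apply/ffunP => i.
  by rewrite !ffunE; exact: Bx.
have [pD0 _] := hD.
rewrite esumZl; last 2 first.
- by rewrite mulr_ge0 ?channel_law_ge0.
- by move=> x; rewrite lee_fin; do 2! apply: prodr_ge0 => ? _.
(* The group is a product set over slots, each factor being a product set over users. *)
rewrite (@esum_finfun _ _ _ [ffun=> 0%N] (fun _ y => \prod_i pD M (y i)) B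
  (fun t => \prod_i clip_pmf (d t i))).
- by rewrite -EFinM mulrAC.
- by move=> t x; apply: prodr_ge0 => ? _.
- move=> t; apply: (@esum_finfun _ _ _ 0%N (fun _ => pD M)
    (fun i => [set x | clip x = d t i]) (fun i => clip_pmf (d t i))) => // i.
  exact: pr_pDE.
Qed.

End FiniteExpectation.

(** * Sequential summation *)

Section PartialSum.
Variables (R : realType) (m : nat) (Y : finType).
Variable K : 'I_m -> {ffun 'I_m -> Y} -> Y -> R.
Implicit Types (w : {ffun 'I_m -> Y}) (f g : {ffun 'I_m -> Y} -> R).

Definition agree_from (k : nat) w w' :=
  [forall i : 'I_m, (k <= i)%N ==> (w' i == w i)].

Lemma agree_fromP k w w' :
  reflect (forall i : 'I_m, (k <= i)%N -> w' i = w i) (agree_from k w w').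
Proof.
apply: (iffP forallP) => [H i ki|H i]; first by have /implyP/(_ ki)/eqP := H i.
by apply/implyP => ki; rewrite H.
Qed.

(** Ordinals decrease in time: coordinates [>= k] are the slots up to and including slot [k.+1], so
    this is measurability with respect to the past. *)
Definition adapted_from (k : nat) T (f : {ffun 'I_m -> Y} -> T) :=
  forall w w', (forall i : 'I_m, (k <= i)%N -> w' i = w i) -> f w' = f w.

Definition upd w (k : 'I_m) y : {ffun 'I_m -> Y} :=
  [ffun i => if i == k then y else w i].

(* The expectation of [f] when the coordinates [>= k] are frozen to those of
   [w] and the others are drawn successively from the kernels [K]. *)
Definition psum (k : nat) f w : R :=
  \sum_(w' | agree_from k w w') (\prod_(i < m | (i < k)%N) K i w' (w' i)) * f w'.

Hypothesis K_adapted : forall (k : 'I_m) y, adapted_from k.+1 (fun w => K k w y).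

Lemma psum0 f w : psum 0 f w = f w.
Proof.
rewrite /psum (big_pred1 w) ?big_pred0 ?mul1r// => w'.
apply/agree_fromP/eqP => [H|->//].
by apply/ffunP => i; rewrite H.
Qed.

Lemma adapted_upd (k : 'I_m) w y T (f : {ffun 'I_m -> Y} -> T) :
  adapted_from k.+1 f -> f (upd w k y) = f w.
Proof.
by move=> fk; apply: fk => i ki; rewrite ffunE; case: eqP ki => // ->; rewrite ltnn.
Qed.

(** Coordinate [k] is the earliest in time that is not frozen; its kernel sees only frozen
    coordinates and so leaves the sum over the later slots. *)
Lemma psumS (k : 'I_m) f w :
  psum k.+1 f w = \sum_y K k w y * psum k f (upd w k y).
Proof.
rewrite /psum (partition_big (fun w' => w' k) xpredT)//=.
apply: eq_bigr => y _; rewrite big_distrr/=.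
rewrite (eq_bigl (agree_from k (upd w k y))) => [|w']; last first.
  apply/andP/agree_fromP => [[/agree_fromP H /eqP wy] i ki|H].
    rewrite ffunE; case: eqP => [->//|/eqP ik]; apply: H.
    by rewrite ltn_neqAle ki andbT eq_sym.
  split; last by rewrite H// ffunE eqxx.
  apply/agree_fromP => i ki; rewrite H ?ffunE 1?ltnW//.
  by case: eqP ki => // ->; rewrite ltnn.
apply: eq_bigr => w' /agree_fromP H.
rewrite (bigD1 k)//= mulrA; congr (_ * _ * _).
  rewrite -(adapted_upd w y (K_adapted y)).
  rewrite [w' k](_ : _ = y); last by rewrite H// ffunE eqxx.
  by apply: K_adapted => i ki; apply: H; exact: ltnW.
apply: eq_bigl => i; rewrite ltnS ltn_neqAle.
by rewrite andbC.
Qed.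

(** A tower property: by [psumS], level [k'] is computed from the values at level [k] alone. *)
Lemma psum_eq (k k' : nat) f g : (k <= k' <= m)%N ->
  (forall w, psum k f w = psum k g w) -> forall w, psum k' f w = psum k' g w.
Proof.
move=> /andP[kk' k'm] fg; elim: k' kk' k'm => [|k' IH].
  by rewrite leqn0 => /eqP k0 _ w; rewrite -k0.
rewrite leq_eqVlt => /predU1P[<- _ //|]; rewrite ltnS => kk' k'm w.
rewrite -[k']/(val (Ordinal k'm)) !psumS; apply: eq_bigr => y _.
by rewrite /= IH// ltnW.
Qed.

Lemma psum_all f w : psum m f w = \sum_w' (\prod_i K i w' (w' i)) * f w'.
Proof.
apply: eq_big => [w'|w' _].
  by apply/agree_fromP => i; rewrite leqNgt ltn_ord.
by congr (_ * _); apply: eq_bigl => i; rewrite ltn_ord.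
Qed.

Hypothesis K1 : forall k w, \sum_y K k w y = 1.

Lemma psum_adapted (k : nat) f w : (k <= m)%N -> adapted_from k f ->
  psum k f w = f w.
Proof.
elim: k w => [|k IH] w km fk; first exact: psum0.
rewrite -[k]/(val (Ordinal km)) psumS/=.
transitivity (\sum_y K (Ordinal km) w y * f w); last by rewrite -mulr_suml K1 mul1r.
apply: eq_bigr => y _; rewrite IH ?(ltnW km)//.
  by congr (_ * _); exact: (@adapted_upd (Ordinal km)).
by move=> w1 w2 H; apply: fk => i /ltnW; exact: H.
Qed.

End PartialSum.

(** * Delays read by an adaptive scheduler *)

Section DelayStep.
Variables (R : realType) (m N : nat).
Variable q : 'I_m.+1 -> R.
Hypothesis q1 : \sum_c q c = 1.

Local Notation delays := {ffun 'I_m -> {ffun 'I_N -> 'I_m.+1}}.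
Let K (_ : 'I_m) (_ : delays) (y : {ffun 'I_N -> 'I_m.+1}) := \prod_i q (y i).

Let K_adapted (k : 'I_m) y : adapted_from k.+1 (fun w => K k w y).
Proof. by []. Qed.

Let K_marginal (j : 'I_N) (G : 'I_m.+1 -> R) (k : 'I_m) (w : delays) :
  \sum_y K k w y * G (y j) = \sum_c q c * G c.
Proof.
(* Factors [1] for the users other than [j] let the sum split over users. *)
pose H (i : 'I_N) c := q c * (if i == j then G c else 1).
transitivity (\sum_(y : {ffun 'I_N -> 'I_m.+1}) \prod_i H i (y i)).
  apply: eq_bigr => y _; rewrite big_split/=; congr (_ * _).
  by rewrite -big_mkcond big_pred1_eq.
rewrite -bigA_distr_bigA (bigD1 j)//= [X in _ * X]big1 ?mulr1.
  by apply: eq_bigr => c _; rewrite /H eqxx.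
by move=> i ij; rewrite -[RHS]q1; apply: eq_bigr => c _; rewrite /H (negbTE ij) mulr1.
Qed.

Let K1 k w : \sum_y K k w y = 1.
Proof.
by rewrite /K -(bigA_distr_bigA (fun (_ : 'I_N) c => q c)) big1.
Qed.

(** The user [a k] is chosen from the delays of earlier slots, so the delay read at index [k] is
    fresh and has law [q] whatever the choice. This is why the age of the feedback does not depend
    on the policy. *)
Lemma adaptive_delays (a : 'I_m -> delays -> 'I_N) (G : 'I_m -> 'I_m.+1 -> R) :
  (forall k : 'I_m, adapted_from k.+1 (a k)) ->
  \sum_(d : delays) (\prod_t \prod_i q (d t i)) * (\prod_k G k (d k (a k d))) =
  \prod_k \sum_c q c * G k c.
Proof.
move=> a_adapted.
(* The factors with index below [k] are averaged out first; [f k] keeps the others. *)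
pose f k (d : delays) := \prod_(i < m | (k <= i)%N) G i (d i (a i d)).
have f_adapted k : adapted_from k (f k).
  move=> w w' ww'; apply: eq_bigr => i ki; rewrite ww'//.
  by rewrite (a_adapted i w w')// => j ij; apply: ww'; rewrite (leq_trans ki)// ltnW.
have step k (w : delays) : (k <= m)%N ->
    psum K k (f 0%N) w = f k w * \prod_(i < m | (i < k)%N) \sum_c q c * G i c.
  elim: k w => [|k IH] w km; first by rewrite psum0 big_pred0 ?mulr1.
  rewrite -[k]/(val (Ordinal km)) psumS//=.
  set k' := Ordinal km; rewrite [X in _ * X](bigD1 k')//=.
  under eq_bigr => y _.
    rewrite IH 1?ltnW// {1}/f (bigD1 k')//= ffunE eqxx.
    rewrite (adapted_upd w y (a_adapted k')).
    rewrite [X in _ * X * _](_ : _ = f k.+1 w); last first.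
      rewrite -(adapted_upd (k := k') w y (f_adapted k.+1)).
      by apply: eq_bigl => i; rewrite ltn_neqAle andbC eq_sym.
    rewrite -mulrA mulrA; over.
  rewrite -mulr_suml K_marginal mulrCA; congr (_ * (_ * _)).
  by apply: eq_bigl => i; rewrite ltnS ltn_neqAle andbC.
(* At level [m] nothing is frozen, so any base point serves. *)
have [d0|] := pickP (fun _ : delays => true); last first.
  by move=> /(_ [ffun=> [ffun=> ord0]]).
move=> _.
transitivity (psum K m (f 0%N) d0); first by rewrite psum_all.
have f1 : f m d0 = 1 by apply: big_pred0 => i; rewrite leqNgt ltn_ord.
rewrite step// f1 mul1r.
by apply: eq_bigl => i; rewrite ltn_ord.
Qed.

End DelayStep.

(** * Markov property of the channels *)

Section ChannelStep.
Variables (R : realType) (M : downlink R) (N m : nat).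
Hypothesis hpr : pON M - rON M < 1.

Local Notation states := {ffun 'I_m -> {ffun 'I_N -> bool}}.
Local Notation T := (Tmap M).

Lemma Tmap_p_s : T (p_s M) = p_s M.
Proof.
rewrite /Tmap /p_s; field.
by rewrite subr_eq0 gt_eqF.
Qed.

Lemma iter_Tmap_p_s n : iter n T (p_s M) = p_s M.
Proof. by elim: n => //= n ->; exact: Tmap_p_s. Qed.

(* Slot [m.+1] is a virtual slot in which every user has the stationary belief;
   this is consistent with the initial law since [T] fixes [p_s M]. *)
Definition slot_mean (u : nat) (S : states) (i : 'I_N) : R :=
  if u == m.+1 then p_s M else (slot_states S u i)%:R.

Let K (k : 'I_m) (S : states) (y : {ffun 'I_N -> bool}) : R :=
  \prod_i bernoulli_pmf (T (slot_mean k.+2 S i)) (y i).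

Let slot_mean_adapted u i : (0 < u)%N -> adapted_from u.-1 (fun S => slot_mean u S i).
Proof.
move=> u0 S S' SS'; rewrite /slot_mean; case: eqP => // _.
rewrite /slot_states; case: insubP => //= v _ vu.
by rewrite SS'// vu.
Qed.

Let K_adapted (k : 'I_m) y : adapted_from k.+1 (fun S => K k S y).
Proof.
move=> S S' SS'; apply: eq_bigr => i _; congr (bernoulli_pmf (T _) _).
exact: slot_mean_adapted.
Qed.

(** Given the previous slot the channels are independent, and each state enters affinely, so it may
    be replaced by its mean. *)
Let K_affine (a b : 'I_N -> R) (k : 'I_m) (S : states) :
  \sum_y K k S y * \prod_i (a i + b i * (y i)%:R) =
  \prod_i (a i + b i * T (slot_mean k.+2 S i)).
Proof.
pose H (i : 'I_N) c :=
  bernoulli_pmf (T (slot_mean k.+2 S i)) c * (a i + b i * c%:R).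
transitivity (\sum_(y : {ffun 'I_N -> bool}) \prod_i H i (y i)).
  by apply: eq_bigr => y _; rewrite big_split.
rewrite -bigA_distr_bigA; apply: eq_bigr => i _.
by rewrite big_bool /H/=; ring.
Qed.

Let K1 k S : \sum_y K k S y = 1.
Proof.
rewrite /K -(bigA_distr_bigA
  (fun i c => bernoulli_pmf (T (slot_mean k.+2 S i)) c)) big1// => i _.
by rewrite big_bool /bernoulli_pmf/=; ring.
Qed.

Lemma iter_Tmap_affine n x : iter n T x = iter n T 0 + (iter n T 1 - iter n T 0) * x.
Proof. by elim: n => [|n /= ->]; rewrite /Tmap/=; ring. Qed.

Lemma channel_lawE S :
  channel_law M (fun=> p_s M) S = \prod_k K k S (S k).
Proof.
rewrite /channel_law exchange_big/= big_add1/= big_mkord; apply: eq_bigr => k _.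
apply: eq_bigr => i _; rewrite slot_statesE; congr bernoulli_pmf.
rewrite /slot_mean eqSS; case: ifP => _; first by rewrite Tmap_p_s.
by case: (slot_states S k.+2 i); rewrite /Tmap/=; ring.
Qed.

(** Since [h] sees only the slots up to and including [j], the state in slot [t] may be averaged
    given slot [j]. Products of affine factors are stable under a transition, and they cover both
    the state of one user and the event that all users are OFF. *)
Lemma channel_markov (a b : 'I_N -> R) (h : states -> R) (t j : nat) :
  (0 < t <= j)%N -> (j <= m.+1)%N -> adapted_from j.-1 h ->
  \sum_S channel_law M (fun=> p_s M) S *
    (h S * \prod_i (a i + b i * slot_mean t S i)) =
  \sum_S channel_law M (fun=> p_s M) S *
    (h S * \prod_i (a i + b i * iter (j - t) T (slot_mean j S i))).
Proof.
move=> /andP[t0 tj] jm h_adapted.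
(* Interpolates between the two integrands: [n = 0] on the left, [n = j - t] on the right. *)
pose f n S := h S * \prod_i (a i + b i * iter n T (slot_mean (t + n) S i)).
have step n S : (t + n <= j)%N -> psum K (t + n).-1 (f 0%N) S = f n S.
  elim: n S => [|n IH] S tnj.
    rewrite psum_adapted// ?addn0.
      by rewrite -ltnS prednK//; exact: leq_trans jm.
    move=> w w' ww'; congr (_ * _).
      by apply: h_adapted => i ji; apply: ww'; move: ji tnj; lia.
    by apply: eq_bigr => i _; rewrite /= addn0 (slot_mean_adapted _ _ ww').
  have km : ((t + n).-1 < m)%N.
    by rewrite prednK ?addn_gt0 ?t0//; move: tnj jm; lia.
  pose k := Ordinal km.
  have tnE : (t + n = k.+1)%N by rewrite /k/= prednK ?addn_gt0 ?t0.
  rewrite addnS/= tnE psumS//.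
  transitivity (\sum_y h S * (K k S y * \prod_i
      ((a i + b i * iter n T 0) +
       (b i * (iter n T 1 - iter n T 0)) * (y i)%:R))).
    apply: eq_bigr => y _; rewrite /= IH; last by move: tnj; lia.
    rewrite mulrCA; congr (_ * _).
      apply: (@adapted_upd _ _ k) => w w' ww'; apply: h_adapted => i ji.
      by apply: ww'; move: ji tnj tnE; lia.
    congr (_ * _); apply: eq_bigr => i _.
    rewrite iter_Tmap_affine tnE /slot_mean eqSS ltn_eqF ?ltn_ord//.
    by rewrite slot_statesE ffunE eqxx; ring.
  rewrite -mulr_sumr K_affine; congr (_ * _); apply: eq_bigr => i _.
  by rewrite addnS tnE iterSr [in RHS]iter_Tmap_affine; ring.
have [S0|] := pickP (fun _ : states => true); last first.
  by move=> /(_ [ffun=> [ffun=> false]]).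
move=> _.
have jE : (t + (j - t) = j)%N by rewrite subnKC.
have fj S : psum K j.-1 (f 0%N) S = psum K j.-1 (f (j - t)%N) S.
  rewrite -{1}jE step ?jE// psum_adapted//; first by move: jm; lia.
  move=> w w' ww'; congr (_ * _); first exact: h_adapted.
  apply: eq_bigr => i _; rewrite jE (slot_mean_adapted _ _ ww')//.
  exact: leq_trans tj.
have := psum_eq K_adapted (k' := m) _ fj S0.
have -> : (j.-1 <= m <= m)%N by move: jm; lia.
move=> /(_ isT); rewrite !psum_all.
under eq_bigr do rewrite -channel_lawE /f addn0.
move=> ->.
by apply: eq_bigr => S _; rewrite channel_lawE /f jE.
Qed.

Lemma channel_law_sum1 : \sum_(S : states) channel_law M (fun=> p_s M) S = 1.
Proof.
have [S0|] := pickP (fun _ : states => true); last first.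
  by move=> /(_ [ffun=> [ffun=> false]]).
move=> _; have := psum_adapted K_adapted K1 (f := fun=> 1) S0 (leqnn m).
rewrite psum_all => <- //.
by apply: eq_bigr => S _; rewrite channel_lawE mulr1.
Qed.

End ChannelStep.

(** * Information *)

Section Information.
Variables (N m : nat) (F : feedback N) (A : policy F).
Implicit Types w : outcome N m.

Lemma schedule_decision w n : (n <= m)%N ->
  schedule A w n = [seq ((m - i)%N, decision A w (m - i)%N) | i <- iota 0 n].
Proof.
elim: n => // n IH nm; rewrite -addn1 iotaD map_cat -IH ?(ltnW nm)//= add0n.
by rewrite addn1 /= -cats1 /decision /info subKn// ltnW.
Qed.

Lemma info_schedule w t : (t <= m)%N ->
  info A w t = observe F w t [seq (u, decision A w u) |
                              u <- [seq (m - i)%N | i <- iota 0 (m - t)]].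
Proof. by move=> tm; rewrite /info schedule_decision ?leq_subr// -map_comp. Qed.

(** Induction in the order of time: equal information gives equal decisions, so the next
    observations read the same entries. The second alternative covers feedback that is too late for
    slot [t] in both outcomes, where even the delays may differ. *)
Lemma info_eq w w' t :
  (forall u, (t < u <= m)%N -> let a := decision A w u in
    (delay w' u a = delay w u a /\
      ((delay w u a + t < u)%N -> state w' u = state w u)) \/
    (u <= delay w u a + t /\ u <= delay w' u a + t)%N) ->
  forall k, (t <= k <= m)%N -> info A w' k = info A w k.
Proof.
move=> H.
have obs n : (n <= m - t)%N ->
    observe F w' (m - n) (schedule A w n) = observe F w (m - n) (schedule A w n).
  move=> nm; rewrite schedule_decision ?(leq_trans nm) ?leq_subr//.
  rewrite /observe -!map_comp; apply/eq_in_map => i.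
  rewrite mem_iota add0n leq0n /= => ni.
  have um : (t < m - i <= m)%N by rewrite leq_subr andbT; lia.
  have [[-> e]|[e1 e2]] := H _ um.
    by case: ifP => // dk; rewrite e//; lia.
  by rewrite !ifF//; lia.
have sch n : (n <= m - t)%N -> schedule A w' n = schedule A w n.
  by elim: n => //= n IH nm; rewrite IH ?(ltnW nm)// obs// ltnW.
move=> k /andP[tk km]; rewrite /info sch; last by rewrite leq_sub2l.
by have := obs (m - k)%N; rewrite subKn//; apply; exact: leq_sub2l.
Qed.

(** The first [n] decisions consult only histories of size less than [n]; the recursive construction
    of a greedy policy rests on this. *)
Lemma schedule_local (A' : policy F) w n :
  (forall k h, (size h < n)%N -> A k h = A' k h) ->
  forall j, (j <= n)%N -> schedule A w j = schedule A' w j.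
Proof.
move=> AA'; elim=> //= j IH jn; rewrite IH ?(ltnW jn)//; congr rcons; congr (_, _).
apply: AA'; rewrite size_map -IH ?(ltnW jn)//.
suff -> : forall i, size (schedule A w i) = i by [].
by elim=> //= i IHi; rewrite size_rcons IHi.
Qed.

Lemma delay_unclip (S : {ffun 'I_m -> {ffun 'I_N -> bool}}) d u i :
  delay (S, unclip (clip_delays d)) u i = minn (delay (S, d) u i) m.
Proof.
rewrite /delay /=; case: insubP => [v _ _|_] /=; last by rewrite !ffunE min0n.
by rewrite !ffunE /clip inordK// ltnS geq_minr.
Qed.

(** Feedback with delay at least [m] never arrives within the horizon. This gives the invariance
    that [esum_law] asks for. *)
Lemma info_clip (S : {ffun 'I_m -> {ffun 'I_N -> bool}}) d k : (k <= m)%N ->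
  info A (S, unclip (clip_delays d)) k = info A (S, d) k.
Proof.
move=> km; apply: (@info_eq _ _ 0%N) => // u /andP[u0 um] a.
rewrite delay_unclip !addn0; have [dm|md] := leqP (delay (S, d) u a) m.
  by left.
by right; split=> //; rewrite (leq_trans um)// ltnW.
Qed.

End Information.

(** * Beliefs *)

(** Exchanging the sums collects, for each [z], the mass of its class divided by itself. *)
Lemma conditional_mean (R : realFieldType) (Z : finType) (mu : Z -> R)
    (E : rel Z) (f : Z -> R) : (forall z, 0 <= mu z) -> equivalence_rel E ->
  \sum_z mu z * ((\sum_z' mu z' * (f z' * (E z z')%:R)) /
                 (\sum_z' mu z' * (E z z')%:R)) = \sum_z mu z * f z.
Proof.
move=> mu0 /equivalence_relP[Er Et].
pose D z := \sum_z' mu z' * (E z z')%:R.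
have DE z z' : E z z' -> D z = D z'.
  by move=> /Et Ezz'; apply: eq_bigr => y _; rewrite Ezz'.
have Esym z z' : E z z' = E z' z.
  by apply/idP/idP => /[dup] /Et <-; rewrite Er.
transitivity (\sum_z \sum_z' mu z * (mu z' * (f z' * (E z z')%:R)) / D z').
  apply: eq_bigr => z _; rewrite mulrA mulr_sumr mulr_suml.
  apply: eq_bigr => z' _; case: (boolP (E z z')) => [/DE <- //|_].
  by rewrite !mulr0 !mul0r.
rewrite exchange_big/=; apply: eq_bigr => z _.
transitivity (mu z * f z * (D z / D z)).
  rewrite /D mulr_suml mulr_sumr -/(D z); apply: eq_bigr => z' _.
  by rewrite Esym; ring.
(* Division by 0 gives 0, which is harmless: in a class of mass 0 every [mu z] vanishes. *)
have [D0|D0] := eqVneq (D z) 0; last by rewrite divff ?mulr1.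
suff -> : mu z = 0 by rewrite !mul0r.
have mu1 z' : 0 <= mu z' * (E z z')%:R by rewrite mulr_ge0.
have /eqP := D0; rewrite psumr_eq0// => /allP/(_ z (mem_index_enum z))/=.
by rewrite Er mulr1 => /eqP.
Qed.

Section Tower.
Variables (R : realType) (M : downlink R) (N : nat).
Hypotheses (hp : 0 <= pON M <= 1) (hr : 0 <= rON M <= 1) (hD : is_pmf (pD M)).
Variables (pi : 'I_N -> R) (F : feedback N) (A : policy F) (m : nat).
Hypothesis hpi : forall i, 0 <= pi i <= 1.
Implicit Types w : outcome N m.

Lemma fin_ex_le (f g : outcome N m -> R) : (forall w, f w <= g w) ->
  fin_ex M pi f <= fin_ex M pi g.
Proof.
move=> fg; apply: ler_sum => S _; apply: ler_sum => d _.
by rewrite ler_wpM2l// mulr_ge0 ?channel_law_ge0 ?delay_law_ge0.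
Qed.

Lemma eq_fin_ex (f g : outcome N m -> R) : f =1 g -> fin_ex M pi f = fin_ex M pi g.
Proof. by move=> fg; congr fin_ex; apply/funext. Qed.

Lemma fin_ex_sum (I : Type) (r : seq I) (P : pred I) (f : I -> outcome N m -> R) :
  fin_ex M pi (fun w => \sum_(i <- r | P i) f i w) =
  \sum_(i <- r | P i) fin_ex M pi (f i).
Proof.
rewrite /fin_ex [RHS]exchange_big; apply: eq_bigr => S _ /=.
rewrite [RHS]exchange_big; apply: eq_bigr => d _ /=.
by rewrite mulr_sumr.
Qed.

Lemma pr_law (B : pred (outcome N m)) :
  (forall S d, B (S, unclip (clip_delays d)) = B (S, d)) ->
  pr (law M pi (m := m)) [set w | B w] = fin_ex M pi (fun w => (B w)%:R).
Proof.
move=> Bclip; rewrite /pr esum_mkcond.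
transitivity (fine (\esum_(w in [set: outcome N m]) (law M pi w * (B w)%:R)%:E)).
  congr fine; apply: eq_esum => w _.
  case: (boolP (B w)) => Bw; first by rewrite mem_set// mulr1.
  by rewrite memNset ?mulr0//=; exact/negP.
by rewrite esum_law// => S d; rewrite Bclip.
Qed.

Lemma beliefE k i w : (k <= m)%N ->
  belief M A pi k i w =
  fin_ex M pi (fun w' => (state w' k i)%:R * `[< info A w' k = info A w k >]%:R) /
  fin_ex M pi (fun w' => `[< info A w' k = info A w k >]%:R).
Proof.
move=> km; rewrite /belief /cond_pr.
rewrite (_ : [set w' | info A w' k = info A w k] =
             [set w' | `[< info A w' k = info A w k >]]); last first.
  by apply/seteqP; split => w' /asboolP.
rewrite (_ : _ `&` _ = [set w' | state w' k i && `[< info A w' k = info A w k >]]);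
  last by apply/seteqP; split => w' /=; move=> /andP.
rewrite !pr_law; last 2 first.
- by move=> S d; rewrite info_clip.
- by move=> S d; rewrite info_clip.
by congr (_ / _); apply: eq_fin_ex => w'; rewrite -natrM mulnb.
Qed.

Lemma belief_clip k i S d : (k <= m)%N ->
  @belief R M N F A pi m k i (S, unclip (clip_delays d)) =
  @belief R M N F A pi m k i (S, d).
Proof. by move=> km; rewrite /belief info_clip. Qed.

Lemma belief_ge0 k i w : 0 <= belief M A pi k i w.
Proof.
by apply: divr_ge0; apply: fine_ge0; apply: esum_ge0 => w' _;
  rewrite lee_fin law_ge0.
Qed.

(** The choice [c] is constant on each class of equal information, so [conditional_mean] applies. It
    need not be the decision of [A]: this allows comparing [A] with another rule on the information
    that [A] produced. *)
Lemma fin_ex_belief (c : history F -> 'I_N) k : (k <= m)%N ->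
  fin_ex M pi (fun w => belief M A pi k (c (info A w k)) w) =
  fin_ex M pi (fun w => (state w k (c (info A w k)))%:R).
Proof.
move=> km; rewrite /fin_ex !pair_bigA/=.
pose Z := ({ffun 'I_m -> {ffun 'I_N -> bool}} *
           {ffun 'I_m -> {ffun 'I_N -> 'I_m.+1}})%type.
pose o (z : Z) : outcome N m := (z.1, unclip z.2).
pose mu (z : Z) := channel_law M pi z.1 * delay_law M z.2 : R.
pose E (z z' : Z) := `[< info A (o z') k = info A (o z) k >].
rewrite -(@conditional_mean _ _ mu E (fun z => (state (o z) k (c (info A (o z) k)))%:R)).
- apply: eq_bigr => -[S d] _; congr (_ * _); rewrite beliefE//.
  rewrite /fin_ex !pair_bigA/=; congr (_ / _).
  apply: eq_bigr => -[S' d'] _ /=; congr (_ * _).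
  rewrite -/(o (S', d')) /E; case: asboolP => [->//|]; by rewrite !mulr0.
- by move=> z; rewrite mulr_ge0 ?channel_law_ge0 ?delay_law_ge0.
- move=> x y z; split; first exact/asboolP.
  by move=> /asboolP xy; apply/asboolP/asboolP => ->.
Qed.

Lemma value_fin_ex :
  value M A pi m = \sum_(1 <= t < m.+1)
    fin_ex M pi (fun w => belief M A pi t (decision A w t) w).
Proof.
rewrite /value /ex esum_law//=.
- rewrite fin_ex_sum; apply: eq_bigr => t _. by [].
- by move=> w; apply: sumr_ge0 => t _; exact: belief_ge0.
- move=> S d; apply: eq_big_nat => t /andP[t1 tm].
  by rewrite belief_clip// /decision info_clip.
Qed.

Lemma value_reward :
  value M A pi m = \sum_(1 <= t < m.+1)
    fin_ex M pi (fun w => (state w t (decision A w t))%:R).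
Proof.
rewrite value_fin_ex; apply: eq_big_nat => t /andP[t1 tm].
exact: (fin_ex_belief (A t)).
Qed.

End Tower.

(** * Latest available feedback *)

(** Writes the two factors of [freshest] as one product over all slots, the form that
    [adaptive_delays] takes. *)
Lemma prod_ord_split (R : comNzRingType) (m t s : nat) (g h : nat -> R) :
  (s <= m)%N ->
  \prod_(k < m) (if (t <= k < s)%N then g k else if k == s :> nat then h k else 1) =
  \prod_(t <= v < s) g v * (if (s < m)%N then h s else 1).
Proof.
move=> sm; transitivity (\prod_(k < m) (if (t <= k < s)%N then g k else 1) *
    \prod_(k < m) (if k == s :> nat then h k else 1)).
  rewrite -big_split/=; apply: eq_bigr => k _; case: ifP; last by rewrite mul1r.
  by move=> /andP[_ ks]; rewrite ltn_eqF ?mulr1.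
rewrite -!big_mkcond/=; congr (_ * _).
  by rewrite big_geq_mkord (big_ord_widen_cond m (leq t)).
case: ltnP => [ltsm|ms]; first by rewrite (big_pred1 (Ordinal ltsm)).
by rewrite big_pred0// => k; rewrite ltn_eqF// (leq_trans (ltn_ord k)).
Qed.

Section ClippedDelay.
Variables (R : realType) (M : downlink R) (m : nat).
Hypothesis hD : is_pmf (pD M).

Lemma clip_pmf_sum (P : pred 'I_m.+1) :
  \sum_(c < m.+1) clip_pmf M c * (P c)%:R = pr (pD M) [set d | P (clip m d)].
Proof.
have [pD0 _] := hD.
apply: EFin_inj; rewrite -(pr_pDE hD) esum_mkcond (esum_fiber (clip m)); last first.
  by move=> d; case: ifP => //; rewrite lee_fin.
rewrite -sumEFin; apply: eq_bigr => c _.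
have [Pc|Pc] := boolP (P c); last first.
  by rewrite mulr0 esum1// => d /= dc; rewrite memNset//= dc; exact/negP.
rewrite mulr1 -(pr_pDE hD); apply: eq_esum => d /= dc.
by rewrite mem_set//= dc.
Qed.

Lemma pr_pD_setT : pr (pD M) [set: nat] = 1.
Proof. by apply: EFin_inj; rewrite -(pr_pDE hD); case: hD. Qed.

Lemma clip_pmf_sum1 : \sum_(c < m.+1) clip_pmf M c = 1 :> R.
Proof.
rewrite -pr_pD_setT -[setT](_ : [set d | predT (clip m d)] = _).
  by rewrite -clip_pmf_sum; apply: eq_bigr => c _; rewrite mulr1.
exact/seteqP.
Qed.

Lemma pr_pD_gt d :
  pr (pD M) [set d' | (d < d')%N] = 1 - pr (pD M) [set d' | (d' <= d)%N].
Proof.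
rewrite -pr_pD_setT; apply: EFin_inj; rewrite EFinB -!(pr_pDE hD).
rewrite (esumID [set d' | (d' <= d)%N] setT); last first.
  by move=> d0 _; rewrite lee_fin; case: hD.
rewrite !setTI !(pr_pDE hD) -EFinD addrAC subrr add0r.
congr (_ _ _)%:E.
by apply/seteqP; split => x /=; rewrite ltnNge => /negP.
Qed.

Lemma clip_pmf_le t v : (t <= v < m)%N ->
  \sum_(c < m.+1) clip_pmf M c * ((c + t <= v)%N)%:R =
  pr (pD M) [set d | (d <= v - t)%N] :> R.
Proof.
move=> /andP[tv vm]; rewrite (clip_pmf_sum (fun c => (c + t <= v)%N)).
congr pr; apply/seteqP; split => d /=; rewrite /clip inordK ?ltnS ?geq_minr//; lia.
Qed.

End ClippedDelay.

Section Freshness.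
Variables (R : realType) (M : downlink R) (N : nat) (F : feedback N) (A : policy F).
Variables (m t : nat).
Hypothesis tm : (t <= m)%N.
Implicit Types w : outcome N m.

(** Index [v] stands for slot [v.+1], which turns the strict inequality of [observe] into [<=]. *)
Definition arrived w v := (delay w v.+1 (decision A w v.+1) + t <= v)%N.

(* Indicator of the event that slot [s.+1] is the latest slot whose feedback is
   available in slot [t]; for [s = m], that no feedback is available. *)
Definition freshest (s : nat) w : R :=
  \prod_(t <= v < s) (1 - (arrived w v)%:R) *
  (if (s < m)%N then (arrived w s)%:R else 1).

(** Telescoping: [Q s] indicates that nothing from slots [t.+1] to [s] has arrived, and
    [freshest s w] is [Q s - Q s.+1] for [s < m] and [Q m] for [s = m]. *)
Lemma sum_freshest w : \sum_(t <= s < m.+1) freshest s w = 1.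
Proof.
pose Q s : R := \prod_(t <= v < s) (1 - (arrived w v)%:R).
rewrite big_nat_recr//= {2}/freshest ltnn mulr1 -/(Q m).
rewrite (eq_big_nat _ _ (F2 := fun s => - Q s.+1 - - Q s)); last first.
  move=> s /andP[ts sm]; rewrite /freshest sm -/(Q s).
  have -> : Q s.+1 = Q s * (1 - (arrived w s)%:R) by rewrite /Q big_nat_recr.
  by ring.
have Qt : Q t = 1 by rewrite /Q big_geq.
by rewrite telescope_sumr// Qt; ring.
Qed.

Lemma freshest_ge0 s w : 0 <= freshest s w.
Proof.
rewrite mulr_ge0//; last by case: ifP.
by apply: prodr_ge0 => v _; case: arrived; rewrite ?subrr ?subr0.
Qed.

Lemma freshest_eq0 s w v : (t <= v < s)%N -> arrived w v -> freshest s w = 0.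
Proof.
move=> vs arr; apply/eqP; rewrite mulf_eq0 prodf_seq_eq0; apply/orP; left.
apply/hasP; exists v; first by rewrite mem_index_iota.
by rewrite arr subrr eqxx.
Qed.

Lemma info_freshest s (S S' : {ffun 'I_m -> {ffun 'I_N -> bool}}) d :
  (forall v, (t <= v < s)%N -> ~~ arrived (S, d) v) ->
  (forall i : 'I_m, (s <= i)%N -> S' i = S i) ->
  forall k, (t <= k <= m)%N -> info A (S', d) k = info A (S, d) k.
Proof.
move=> Narr SS'; apply: info_eq => -[//|v] /andP[tv vm] a; left; split=> // arr.
rewrite /state/= insubT//= SS'//=.
rewrite leqNgt; apply/negP => vs.
by have := Narr v; rewrite -ltnS tv vs => /(_ isT); rewrite /arrived -ltnS arr.
Qed.

(** The event involves decisions, hence states. But if nothing from slots [t.+1] to [s] has arrived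
    under one of [S], [S'], then [info_freshest] carries everything over to the other; if this fails
    for both, both sides are 0. *)
Lemma freshest_adapted s d (T : Type) (c : T -> R) (f : history F -> T) :
  (t <= s <= m)%N ->
  adapted_from s (fun S : {ffun 'I_m -> {ffun 'I_N -> bool}} =>
    freshest s (S, d) * c (f (info A (S, d) t))).
Proof.
move=> /andP[ts sm].
have key (S S' : {ffun 'I_m -> {ffun 'I_N -> bool}}) :
    (forall i : 'I_m, (s <= i)%N -> S' i = S i) ->
    (forall v, (t <= v < s)%N -> ~~ arrived (S, d) v) ->
    freshest s (S', d) * c (f (info A (S', d) t)) =
    freshest s (S, d) * c (f (info A (S, d) t)).
  move=> SS' Narr; have infoE := info_freshest Narr SS'.
  rewrite infoE ?leqnn//; congr (_ * _).
  have arrE v : (t <= v < m)%N -> arrived (S', d) v = arrived (S, d) v.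
    by move=> /andP[tv vm]; rewrite /arrived /decision infoE// vm ltnW.
  rewrite /freshest; congr (_ * _).
    apply: eq_big_nat => v /andP[tv vs]; rewrite arrE// tv.
    exact: leq_trans vs sm.
  by case: ifP => // ltsm; rewrite arrE// ts.
move=> S S' SS'.
have [narr|Nnarr] := pselect (forall v, (t <= v < s)%N -> ~~ arrived (S, d) v).
  exact: key.
have [narr'|Nnarr'] := pselect (forall v, (t <= v < s)%N -> ~~ arrived (S', d) v).
  by symmetry; apply: key => // i /SS'.
have zero S1 : ~ (forall v, (t <= v < s)%N -> ~~ arrived (S1, d) v) ->
    freshest s (S1, d) = 0.
  move=> /existsNP[v /not_implyP[vs /negP]]; rewrite negbK; exact: freshest_eq0.
by rewrite !zero// !mul0r.
Qed.

Lemma delay_slot w (k : 'I_m) i : delay w k.+1 i = w.2 k i.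
Proof. by rewrite /delay/= insubT//= => kn; congr (w.2 _ i); apply: val_inj. Qed.

Hypothesis hD : is_pmf (pD M).

(** For fixed channel states the event only concerns the delays of adaptively chosen users, so by
    [adaptive_delays] its probability depends neither on the policy nor on the states. *)
Lemma fin_ex_freshest (pi : 'I_N -> R) (s : nat)
    (g : {ffun 'I_m -> {ffun 'I_N -> bool}} -> R) : (t <= s <= m)%N ->
  fin_ex M pi (fun w => freshest s w * g w.1) =
  (\prod_(0 <= d < s - t) pr (pD M) [set d' | (d < d')%N]) *
  (if (s < m)%N then pr (pD M) [set d | (d <= s - t)%N] else 1) *
  \sum_S channel_law M pi S * g S.
Proof.
move=> /andP[ts sm]; rewrite /fin_ex mulr_sumr; apply: eq_bigr => S _.
transitivity (channel_law M pi S * g S * \sum_d delay_law M d *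
    freshest s (S, unclip d)).
  by rewrite mulr_sumr; apply: eq_bigr => d _ /=; ring.
rewrite mulrC; congr (_ * _).
pose G (k : 'I_m) (c : 'I_m.+1) : R :=
  if (t <= k < s)%N then 1 - ((c + t <= k)%N)%:R
  else if k == s :> nat then ((c + t <= k)%N)%:R else 1.
pose a (k : 'I_m) (d : {ffun 'I_m -> {ffun 'I_N -> 'I_m.+1}}) :=
  decision A (S, unclip d) k.+1.
transitivity (\sum_(d : {ffun 'I_m -> {ffun 'I_N -> 'I_m.+1}})
    (\prod_k \prod_i clip_pmf M (d k i)) * \prod_k G k (d k (a k d))).
  apply: eq_bigr => d _; congr (_ * _); rewrite /freshest.
  rewrite -(@prod_ord_split _ m t s (fun v => 1 - (arrived (S, unclip d) v)%:R)
    (fun v => (arrived (S, unclip d) v)%:R))//.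
  by apply: eq_bigr => k _; rewrite /G /arrived delay_slot/= !ffunE.
rewrite (adaptive_delays (clip_pmf_sum1 _ hD)).
  pose p v := pr (pD M) [set d | (d <= v - t)%N].
  transitivity (\prod_(k < m) (if (t <= k < s)%N then 1 - p k
                               else if k == s :> nat then p k else 1)).
    apply: eq_bigr => k _; rewrite /G.
    case: ifP => [/andP[tk ks]|_].
      rewrite /p -(clip_pmf_le hD (m := m)) ?tk ?ltn_ord//.
      transitivity (\sum_(c < m.+1) (clip_pmf M c - clip_pmf M c * ((c + t <= k)%N)%:R)).
        by apply: eq_bigr => c _; ring.
      by rewrite sumrB clip_pmf_sum1.
    case: ifP => [/eqP ks|_]; first by rewrite (clip_pmf_le hD) ?ks ?ts -?ks ?ltn_ord.
    by rewrite -mulr_suml mulr1 clip_pmf_sum1.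
  rewrite (@prod_ord_split _ m t s (fun v => 1 - p v) p)// -/(p s).
  congr (_ * _); rewrite -{1}[t]add0n big_addn; apply: eq_bigr => d _.
  by rewrite pr_pD_gt// /p addnK.
move=> k d d' dd'; rewrite /a /decision (@info_eq _ _ _ _ (S, unclip d) _ k.+1)//.
  move=> [//|u] /andP[ku um] b; left; split=> //.
  rewrite /delay/= insubT//= !ffunE; rewrite ltnS in ku.
  by rewrite (dd' (Ordinal um)).
by rewrite leqnn ltn_ord.
Qed.

End Freshness.

(** * Expected reward of a slot *)

Section Reward.
Variables (R : realType) (M : downlink R) (N : nat) (F : feedback N) (A : policy F).
Hypotheses (hp : 0 <= pON M <= 1) (hr : 0 <= rON M <= 1) (hD : is_pmf (pD M)).
Hypothesis hpr : 0 <= pON M - rON M < 1.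

Local Notation T := (Tmap M).

Lemma p_s_itv : 0 <= p_s M <= 1.
Proof.
move: hp hr hpr => /andP[p0 p1] /andP[r0 r1] /andP[d0 d1].
rewrite /p_s; have e0 : 0 < 1 - (pON M - rON M) by lra.
by rewrite ler_pdivlMr// ler_pdivrMr//; apply/andP; split; lra.
Qed.

Lemma iter_Tmap_sub n x y :
  iter n T x - iter n T y = (pON M - rON M) ^+ n * (x - y).
Proof.
elim: n => [|n IH] /=; first by rewrite mul1r.
by rewrite exprS -mulrA -IH /Tmap; ring.
Qed.

Lemma iter_Tmap_le n x y : x <= y -> iter n T x <= iter n T y.
Proof.
move=> xy; rewrite -subr_ge0 iter_Tmap_sub mulr_ge0 ?subr_ge0//.
by apply: exprn_ge0; case/andP: hpr.
Qed.

(* The expected reward of a scheduler knowing all the states [l.+1] slots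
   earlier: some user was ON with probability [1 - (1 - p_s M) ^+ N]. *)
Definition lag_reward (l : nat) : R :=
  iter l.+1 T 0 + (iter l.+1 T 1 - iter l.+1 T 0) * (1 - (1 - p_s M) ^+ N).

(** Optimal mean reward in a slot preceded by [n] slots when [N] is 2, and an upper bound in
    general: [l] is the lag of the latest feedback, and the last term is the case where none has
    arrived. *)
Definition slot_reward (n : nat) : R :=
  \sum_(0 <= l < n) lag_reward l * pr (pD M) [set d | (d <= l)%N] *
     (\prod_(0 <= d < l) pr (pD M) [set d' | (d < d')%N]) +
  p_s M * \prod_(0 <= d < n) pr (pD M) [set d' | (d < d')%N].

Variables (m t : nat).
Hypotheses (t0 : (0 < t)%N) (tm : (t <= m)%N).

Lemma reward_markov (c : history F -> 'I_N) :
  fin_ex M (fun=> p_s M) (fun w : outcome N m => (state w t (c (info A w t)))%:R) =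
  fin_ex M (fun=> p_s M) (fun w : outcome N m => \sum_(t <= s < m.+1)
    freshest R A t s w *
    iter (s.+1 - t) T (slot_mean M s.+1 w.1 (c (info A w t)))).
Proof.
have split_user (w : outcome N m) (x : 'I_N -> R) :
    x (c (info A w t)) = \sum_i (c (info A w t) == i)%:R * x i.
  rewrite (bigD1 (c (info A w t)))//= eqxx mul1r big1 ?addr0// => i.
  by rewrite eq_sym => /negbTE ->; rewrite mul0r.
transitivity (fin_ex M (fun=> p_s M) (fun w : outcome N m => \sum_(t <= s < m.+1)
    \sum_i freshest R A t s w * (c (info A w t) == i)%:R * (state w t i)%:R)).
  apply: eq_fin_ex => w; rewrite (split_user w (fun i => (state w t i)%:R)).
  rewrite -[LHS]mul1r -(sum_freshest R A tm w) mulr_suml.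
  apply: eq_bigr => s _; rewrite mulr_sumr.
  by apply: eq_bigr => i _; rewrite mulrA.
rewrite !fin_ex_sum; apply: eq_big_nat => s /andP[ts sm].
transitivity (fin_ex M (fun=> p_s M) (fun w : outcome N m =>
    \sum_i freshest R A t s w * (c (info A w t) == i)%:R *
      iter (s.+1 - t) T (slot_mean M s.+1 w.1 i))); last first.
  apply: eq_fin_ex => w.
  rewrite (split_user w (fun i => iter (s.+1 - t) T (slot_mean M s.+1 w.1 i))).
  by rewrite mulr_sumr; apply: eq_bigr => i _; rewrite mulrA.
rewrite !fin_ex_sum; apply: eq_bigr => i _.
rewrite /fin_ex exchange_big [RHS]exchange_big; apply: eq_bigr => d _ /=.
pose h (S : {ffun 'I_m -> {ffun 'I_N -> bool}}) : R :=
  freshest R A t s (S, unclip d) * (c (info A (S, unclip d) t) == i)%:R.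
have h_adapted : adapted_from s h.
  by apply: (@freshest_adapted R _ _ A m t tm s (unclip d) _
    (fun j => (j == i)%:R) c); rewrite ts -ltnS.
(* Expresses the state of one user as a product of affine factors, as [channel_markov] requires. *)
have pick_user (x : 'I_N -> R) : \prod_j ((j != i)%:R + (j == i)%:R * x j) = x i.
  rewrite (bigD1 i)//= eqxx add0r mul1r big1 ?mulr1// => j /negbTE ->.
  by rewrite mul0r addr0.
have := @channel_markov _ M N m _ (fun j => (j != i)%:R) (fun j => (j == i)%:R)
  h t s.+1 _ _ h_adapted.
rewrite t0 /= leqW// ltnS => markov.
have {}markov := markov _ isT sm.
transitivity (delay_law M d * \sum_S channel_law M (fun=> p_s M) S *
    (h S * \prod_j ((j != i)%:R + (j == i)%:R * slot_mean M t S j))).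
  rewrite mulr_sumr; apply: eq_bigr => S _; rewrite pick_user /slot_mean.
  by rewrite ltn_eqF// /h /state/=; rewrite /slot_states; ring.
rewrite markov; last by case/andP: hpr.
rewrite mulr_sumr; apply: eq_bigr => S _; rewrite pick_user /h.
by ring.
Qed.

(** The case [s == m] is separate: without feedback no ON user can be singled out, so the mean is
    [p_s M] and not [1 - (1 - p_s M) ^+ N]. *)
Definition best_mean (s : nat) (S : {ffun 'I_m -> {ffun 'I_N -> bool}}) : R :=
  if s == m then p_s M else 1 - \prod_i (1 - slot_mean M s.+1 S i).

Lemma prod_onem_bool (x : 'I_N -> bool) :
  \prod_i (1 - (x i)%:R) = (~~ [exists i, x i])%:R :> R.
Proof.
case: (boolP [exists i, x i]) => [/existsP[i xi]|/existsPn Nx].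
  by rewrite (bigD1 i)//= xi subrr mul0r.
by rewrite big1// => i _; rewrite (negbTE (Nx i)) subr0.
Qed.

Lemma best_meanE s S : (s < m)%N ->
  best_mean s S = [exists i, slot_states S s.+1 i]%:R.
Proof.
move=> sm; rewrite /best_mean /slot_mean eqSS ltn_eqF// prod_onem_bool.
by case: [exists i, _]; rewrite ?subr0 ?subrr.
Qed.

Lemma slot_mean_le_best s S i : (s <= m)%N ->
  slot_mean M s.+1 S i <= best_mean s S.
Proof.
rewrite leq_eqVlt => /predU1P[->|sm]; first by rewrite /slot_mean /best_mean !eqxx.
rewrite best_meanE// /slot_mean eqSS ltn_eqF// ler_nat.
case: (boolP (slot_states S s.+1 i)) => // xi.
by rewrite lt0b; apply/existsP; exists i.
Qed.

(** Transporting the product back to the virtual slot [m.+1] turns each factor into [1 - p_s M]. *)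
Lemma sum_best_mean s : (s < m)%N ->
  \sum_(S : {ffun 'I_m -> {ffun 'I_N -> bool}})
    channel_law M (fun=> p_s M) S * best_mean s S =
  1 - (1 - p_s M) ^+ N.
Proof.
move=> sm; have hpr1 : pON M - rON M < 1 by case/andP: hpr.
have sm1 : (0 < s.+1 <= m.+1)%N by rewrite /= ltnS ltnW.
have markov := @channel_markov _ M N m hpr1 (fun=> 1) (fun=> -1) (fun=> 1)
  s.+1 m.+1 sm1 (leqnn _) (fun _ _ _ => erefl).
transitivity (\sum_(S : {ffun 'I_m -> {ffun 'I_N -> bool}})
  (channel_law M (fun=> p_s M) S -
    channel_law M (fun=> p_s M) S *
    (1 * \prod_(i < N) (1 + -1 * slot_mean M s.+1 S i)))).
  apply: eq_bigr => S _; rewrite /best_mean ltn_eqF// mulrBr mulr1 mul1r.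
  by under [in RHS]eq_bigr do rewrite mulN1r.
rewrite sumrB channel_law_sum1// markov; congr (_ - _).
transitivity (\sum_(S : {ffun 'I_m -> {ffun 'I_N -> bool}})
  channel_law M (fun=> p_s M) S *
    (1 - p_s M : R) ^+ N : R); last by rewrite -mulr_suml channel_law_sum1// mul1r.
apply: eq_bigr => S _; congr (_ * _); rewrite mul1r.
rewrite (eq_bigr (fun=> 1 - p_s M)); first by rewrite prodr_const card_ord.
by move=> i _; rewrite /slot_mean eqxx iter_Tmap_p_s// mulN1r.
Qed.

Lemma sum_iter_best_mean s l : (s < m)%N ->
  \sum_S channel_law M (fun=> p_s M) S * iter l.+1 T (best_mean s S) = lag_reward l.
Proof.
move=> sm; have hpr1 : pON M - rON M < 1 by case/andP: hpr.
pose u := iter l.+1 T 0; pose v := iter l.+1 T 1 - iter l.+1 T 0.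
transitivity (\sum_S (channel_law M (fun=> p_s M) S * u +
    channel_law M (fun=> p_s M) S * best_mean s S * v)).
  by apply: eq_bigr => S _; rewrite iter_Tmap_affine -/u -/v; ring.
rewrite big_split/= -!mulr_suml channel_law_sum1// sum_best_mean//.
by rewrite mul1r /lag_reward -/u -/v mulrC.
Qed.

Lemma fin_ex_best :
  fin_ex M (fun=> p_s M) (fun w : outcome N m => \sum_(t <= s < m.+1)
    freshest R A t s w * iter (s.+1 - t) T (best_mean s w.1)) =
  slot_reward (m - t).
Proof.
have hpr1 : pON M - rON M < 1 by case/andP: hpr.
rewrite fin_ex_sum big_nat_recr//= /slot_reward; congr (_ + _).
  rewrite -{1}[t]add0n big_addn; apply: eq_big_nat => l /andP[_ lm].
  have ltm : (l + t < m)%N by lia.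
  have tl : (t <= l + t <= m)%N by rewrite leq_addl ltnW.
  have := fin_ex_freshest A hD (fun=> p_s M)
    (fun S => iter ((l + t).+1 - t) T (best_mean (l + t) S)) tl.
  move=> ->; rewrite ltm addnK subSn ?leq_addl// addnK sum_iter_best_mean//.
  by rewrite mulrC mulrA mulrAC.
have tmm : (t <= m <= m)%N by rewrite tm leqnn.
have := fin_ex_freshest A hD (fun=> p_s M)
  (fun S => iter (m.+1 - t) T (best_mean m S)) tmm.
move=> ->; rewrite ltnn mulr1 mulrC; congr (_ * _).
transitivity (\sum_(S : {ffun 'I_m -> {ffun 'I_N -> bool}})
  channel_law M (fun=> p_s M) S * p_s M).
  by apply: eq_bigr => S _; rewrite /best_mean eqxx iter_Tmap_p_s.
by rewrite -mulr_suml channel_law_sum1// mul1r.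
Qed.

End Reward.

(** * The rule that follows the latest feedback *)

Section LatestFeedback.
Variables (N : nat) (F : feedback N) (sel : 'I_N -> fb_type F -> 'I_N) (i0 : 'I_N).

(* Histories list the past slots in time order, so [foldl] ends up with the
   arrived feedback of the latest slot. *)
Definition latest_rule (h : history F) : 'I_N :=
  foldl (fun a x => if x.2 is Some fd then sel x.1.2 fd.1 else a) i0 h.

Lemma latest_rule_None h1 h2 : all (fun x => ~~ isSome x.2) h2 ->
  latest_rule (h1 ++ h2) = latest_rule h1.
Proof.
move=> h2N; rewrite /latest_rule foldl_cat; move: (foldl _ i0 h1) => a.
elim: h2 h2N => //=.
by move=> [x [fd|]] h2 IH //= /IH.
Qed.

Lemma latest_ruleE (A : policy F) (m t s : nat) (w : outcome N m) :
  (t <= s < m)%N -> arrived A t w s ->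
  (forall v, (t <= v < s)%N -> ~~ arrived A t w v) ->
  latest_rule (info A w t) =
  sel (decision A w s.+1) (fb_map F (decision A w s.+1) (state w s.+1)).
Proof.
move=> /andP[ts sm] arr Narr; rewrite info_schedule; last by lia.
(* Cuts the history at slot [s.+1]; the [s - t] entries after it are all [None]. *)
have -> : (m - t = (m - s.+1) + (s - t).+1)%N by lia.
rewrite iotaD !map_cat /observe map_cat /= add0n subKn//.
rewrite -cat_rcons latest_rule_None; last first.
  rewrite !all_map; apply/allP => i; rewrite mem_iota /= => ims.
  have := Narr (m - i).-1; rewrite /arrived prednK; last by lia.
  by move=> N1; rewrite ifF//; have := N1 _; lia.
by rewrite /latest_rule -cats1 foldl_cat /= ifT.
Qed.

End LatestFeedback.

Section RewardBound.
Variables (R : realType) (M : downlink R) (N : nat) (F : feedback N) (A : policy F).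
Hypotheses (hp : 0 <= pON M <= 1) (hr : 0 <= rON M <= 1) (hD : is_pmf (pD M)).
Hypothesis hpr : 0 <= pON M - rON M < 1.
Variables (m t : nat).
Hypotheses (t0 : (0 < t)%N) (tm : (t <= m)%N).

Let hpi : forall i : 'I_N, 0 <= p_s M <= 1.
Proof. by move=> _; exact: p_s_itv. Qed.

Lemma reward_le (c : history F -> 'I_N) :
  fin_ex M (fun=> p_s M) (fun w : outcome N m => (state w t (c (info A w t)))%:R) <=
  slot_reward M N (m - t).
Proof.
rewrite reward_markov// -(fin_ex_best A)//.
apply: fin_ex_le => // w; apply: ler_sum_nat => s /andP[ts sm].
rewrite ler_wpM2l ?freshest_ge0// iter_Tmap_le//.
exact: slot_mean_le_best.
Qed.

(** Equality in [reward_le], as [sel] finds an ON user whenever there is one. The rule acts in slot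
    [t] only, on information produced by an arbitrary [A]. *)
Lemma latest_rule_reward (sel : 'I_N -> fb_type F -> 'I_N) (i0 : 'I_N) :
  (forall a (S : {ffun 'I_N -> bool}),
    S (sel a (fb_map F a S)) = [exists i, S i]) ->
  fin_ex M (fun=> p_s M)
    (fun w : outcome N m => (state w t (latest_rule sel i0 (info A w t)))%:R) =
  slot_reward M N (m - t).
Proof.
move=> selP; rewrite reward_markov// -(fin_ex_best A)//.
apply: eq_fin_ex => w; apply: eq_big_nat => s /andP[ts sm].
have [->|f0] := eqVneq (freshest R A t s w) 0; first by rewrite !mul0r.
congr (_ * iter _ _ _).
move: sm; rewrite ltnS leq_eqVlt => /predU1P[->|sm].
  by rewrite /slot_mean /best_mean !eqxx.
rewrite best_meanE// /slot_mean eqSS ltn_eqF//; congr (_%:R).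
rewrite (@latest_ruleE _ _ _ _ _ _ _ s) ?ts//; first by rewrite selP.
  by move: f0; rewrite /freshest sm mulf_eq0; case: arrived => //; rewrite eqxx orbT.
by move=> v vs; apply: contra_neqN f0 => /(freshest_eq0 R vs).
Qed.

End RewardBound.

(** * Limits and the rate for two users *)

Section Capacity.
Variables (R : realType) (M : downlink R).
Hypotheses (hp : 0 <= pON M <= 1) (hr : 0 <= rON M <= 1) (hD : is_pmf (pD M)).
Hypothesis hpr : 0 <= pON M - rON M < 1.

Local Notation T := (Tmap M).

Let Q (n : nat) : R := \prod_(0 <= d < n) pr (pD M) [set d' | (d < d')%N].
Let P (n : nat) : R := pr (pD M) [set d | (d <= n)%N].

Let P_ge0 n : 0 <= P n. Proof. exact: pr_pD_ge0. Qed.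

Let Q_ge0 n : 0 <= Q n.
Proof. by apply: prodr_ge0 => d _; exact: pr_pD_ge0. Qed.

Let QS n : Q n.+1 = Q n * (1 - P n).
Proof. by rewrite /Q big_nat_recr//= pr_pD_gt. Qed.

Let P_le1 n : P n <= 1.
Proof. by rewrite -subr_ge0 -pr_pD_gt// pr_pD_ge0. Qed.

Let Q_le1 n : Q n <= 1.
Proof.
elim: n => [|n IH]; first by rewrite /Q big_geq.
by rewrite QS mulr_ile1// ?subr_ge0// lerBlDr lerDl.
Qed.

Let sum_PQ n : \sum_(0 <= l < n) P l * Q l = 1 - Q n.
Proof.
elim: n => [|n IH]; first by rewrite /Q !big_geq// subrr.
by rewrite big_nat_recr//= IH QS; ring.
Qed.

Let P_cvg : P n @[n --> \oo] --> (1 : R).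
Proof.
have [pD0 pD1] := hD.
have PE n : P n = \sum_(0 <= d < n.+1) pD M d.
  elim: n => [|n IH].
    apply: EFin_inj; rewrite /P -pr_pDE// big_nat1.
    rewrite [X in esum X](_ : _ = [set 0%N]) ?esum_set1 ?lee_fin//.
    by apply/seteqP; split => d /=; [rewrite leqn0 => /eqP|move=> ->].
  rewrite big_nat_recr//= -IH; apply: EFin_inj; rewrite EFinD /P -!pr_pDE//.
  rewrite (esumID [set d | (d <= n)%N]) => [|d _]; last by rewrite lee_fin.
  congr (_ + _)%E.
    by congr esum; apply/seteqP; split => d /=; [case|move=> dn; split=> //; lia].
  rewrite [X in esum X](_ : _ = [set n.+1]) ?esum_set1 ?lee_fin//.
  apply/seteqP; split => d /=; last by move=> ->; split=> //; apply/negP; lia.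
  by move=> [d1 /negP d2]; lia.
have : (\sum_(0 <= d < n) pD M d)%:E @[n --> \oo] --> (1 : R)%:E.
  rewrite (_ : (fun n => _) = (fun n => \sum_(0 <= d < n) (pD M d)%:E)%E); last first.
    by apply/funext => n; rewrite sumEFin.
  rewrite -pD1 -nneseries_esumT; last by move=> n; rewrite lee_fin.
  by apply: is_cvg_nneseries => n _ _; rewrite lee_fin.
move=> /fine_cvg /= cv.
have -> : P = fun n => \sum_(0 <= d < n.+1) pD M d by exact/funext.
by rewrite (cvg_shiftS (fun n => \sum_(0 <= d < n) pD M d)).
Qed.

(** As [Q n <= 1], [Q n.+1] is at most the tail [1 - P n]. *)
Let Q_cvg : Q n @[n --> \oo] --> (0 : R).
Proof.
rewrite -(cvg_shiftS Q); apply: (@squeeze_cvgr _ _ _ _ (fun=> 0) (fun n => 1 - P n)).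
- apply: nearW => n; rewrite /= Q_ge0 QS.
  by rewrite ler_piMl ?subr_ge0.
- exact: cvg_cst.
- by rewrite -(subrr 1); apply: cvgB => //; exact: cvg_cst.
Qed.

(** Condition on one user in the feedback slot: if ON it yields [iter l.+1 T 1]; if OFF, the other
    user, independent and stationary, yields [p_s M]. *)
Lemma lag_reward2 l :
  lag_reward M 2 l = p_s M * iter l T (pON M) + (1 - p_s M) * p_s M.
Proof.
have hpr1 : pON M - rON M < 1 by case/andP: hpr.
have := iter_Tmap_p_s hpr1 l.+1; rewrite iter_Tmap_affine /lag_reward.
have -> : iter l T (pON M) = iter l.+1 T 1.
  by rewrite iterSr; congr iter; rewrite /Tmap; ring.
set u := iter _ _ 0; set v := iter _ _ 1; set x := p_s M => e.
(* This multiple of [e] makes the goal a linear combination for [lra]. *)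
have : (1 - x) * (u + (v - u) * x) = (1 - x) * x by rewrite e.
move: u v x {e} => u v x e; lra.
Qed.

Lemma lag_reward_itv N l : 0 <= lag_reward M N l <= 1.
Proof.
have iter_itv n x : 0 <= x <= 1 -> 0 <= iter n T x <= 1.
  move=> x01; elim: n => //= n; move: (iter n T x) => y /andP[y0 y1].
  move: hp hr => /andP[p0 p1] /andP[r0 r1]; rewrite /Tmap.
  by apply/andP; split; nra.
have /andP[ps0 ps1] : 0 <= p_s M <= 1 by exact: p_s_itv.
have y0 : 0 <= (1 - p_s M) ^+ N by rewrite exprn_ge0 ?subr_ge0.
have y1 : (1 - p_s M) ^+ N <= 1 by rewrite exprn_ile1 ?subr_ge0// lerBlDr lerDl.
have /andP[u0 _] : 0 <= iter l.+1 T 0 <= 1 by rewrite iter_itv// lexx ler01.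
have /andP[_ v1] : 0 <= iter l.+1 T 1 <= 1 by rewrite iter_itv// lexx ler01.
have uv : iter l.+1 T 0 <= iter l.+1 T 1 by apply: iter_Tmap_le.
rewrite /lag_reward; move: (iter _ _ 0) (iter _ _ 1) (_ ^+ N) u0 v1 uv y0 y1.
by move=> u v y u0 v1 uv y0 y1; apply/andP; split; nra.
Qed.

Let gain (l : nat) : R := lag_reward M 2 l * P l * Q l.

(** The terms are nonnegative and bounded by [P l * Q l], whose partial sums telescope to
    [1 - Q n]. *)
Lemma is_cvg_gain : cvgn (series gain).
Proof.
apply: nondecreasing_is_cvgn.
  apply/nondecreasing_seqP => n; rewrite !seriesEnat /= big_nat_recr//= lerDl.
  by rewrite !mulr_ge0//; case/andP: (lag_reward_itv 2 n).
exists 1 => _ [n _ <-]; rewrite seriesEnat /=.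
apply: (@le_trans _ _ (\sum_(0 <= l < n) P l * Q l)).
  apply: ler_sum => l _; rewrite /gain -mulrA ler_piMl ?mulr_ge0//.
  by case/andP: (lag_reward_itv 2 l).
by rewrite sum_PQ lerBlDr lerDl.
Qed.

Lemma slot_reward_cvg : slot_reward M 2 n @[n --> \oo] --> limn (series gain).
Proof.
rewrite -[limn _]addr0 -(mulr0 (p_s M)).
apply: cvgD; last by apply: cvgMr; exact: Q_cvg.
exact: is_cvg_gain.
Qed.

Let total (m : nat) : R := \sum_(1 <= t < m.+1) slot_reward M 2 (m - t).

Lemma total_cvg : total m / m%:R @[m --> \oo] --> limn (series gain).
Proof.
rewrite -(cvg_shiftS (fun m => total m / m%:R)).
have := cesaro slot_reward_cvg.
apply: cvg_trans; apply: near_eq_cvg; apply: nearW => n.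
rewrite /arithmetic_mean /= mulrC seriesEnat /=; congr (_ * _).
(* Reversing the sum replaces the slot by its distance to the first slot, which gives a Cesaro
   mean. *)
rewrite /total big_add1 /= big_nat_rev /= add0n; apply: eq_big_nat => t /andP[_ tn].
by congr slot_reward; lia.
Qed.

Let hpi : forall i : 'I_2, 0 <= p_s M <= 1.
Proof. by move=> _; exact: p_s_itv. Qed.

Lemma value_le (F : feedback 2) (A : policy F) m :
  value M A (pi_ss M (N := 2)) m <= total m.
Proof.
rewrite value_reward//; apply: ler_sum_nat => t /andP[t1 tm].
exact: (reward_le A hp hr hD hpr t1 tm (A t)).
Qed.

Lemma rate_le (F : feedback 2) (A : policy F) c :
  has_rate M A c -> c <= limn (series gain).
Proof.
move=> Ac; apply: (ler_cvg_to Ac total_cvg); apply: nearW => m.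
by rewrite ler_wpM2r ?invr_ge0// value_le.
Qed.

Section Selection.
Variables (F : feedback 2) (sel : 'I_2 -> fb_type F -> 'I_2).
Hypothesis selP : forall a (S : {ffun 'I_2 -> bool}),
  S (sel a (fb_map F a S)) = [exists i, S i].

Lemma latest_rule_rate :
  has_rate M (fun=> latest_rule sel ord0) (limn (series gain)).
Proof.
rewrite /has_rate; under eq_cvg => m.
  rewrite value_reward// (_ : \sum_(_ <= _ < _) _ = total m); last first.
    apply: eq_big_nat => t /andP[t1 tm].
    exact: (latest_rule_reward (fun=> latest_rule sel ord0) hp hr hD hpr t1 tm ord0 selP).
  over.
exact: total_cvg.
Qed.

(** The value equals [total m] exactly: [value_le] bounds it above, and in each slot the greedy
    belief is at least that of the latest-feedback rule applied to the same information. *)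
Lemma greedy_rate (A : policy F) : greedy M A (pi_ss M (N := 2)) ->
  has_rate M A (limn (series gain)).
Proof.
move=> gA; rewrite /has_rate; under eq_cvg => m.
  rewrite (_ : value _ _ _ m = total m); last first.
    apply/eqP; rewrite eq_le value_le/= value_fin_ex//.
    apply: ler_sum_nat => t /andP[t1 tm].
    rewrite -(latest_rule_reward A hp hr hD hpr t1 tm ord0 selP).
    rewrite -fin_ex_belief//; apply: fin_ex_le => // w; apply: gA.
    by rewrite t1.
  over.
exact: total_cvg.
Qed.

End Selection.

End Capacity.

(** * Existence of a greedy policy *)

Section GreedyExists.
Variables (R : realType) (M : downlink R) (N : nat) (F : feedback N.+1).
Variable pi : 'I_N.+1 -> R.

Definition history_belief (A : policy F) (m k : nat) (i : 'I_N.+1) (h : history F) : R :=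
  cond_pr (law M pi (m := m)) [set w' | state w' k i] [set w' | info A w' k = h].

(** A policy is not given the horizon, but the history in slot [k] has one entry per earlier slot,
    so the horizon is [k + size h]. *)
Definition greedy_step (A : policy F) : policy F := fun k h =>
  [arg max_(i > ord0) history_belief A (k + size h) k i h]%O.

(* [greedy_upto n] is greedy on the histories of size less than [n]; in slot
   [k] a history of size [n] occurs only for the horizon [k + n]. *)
Fixpoint greedy_upto (n : nat) : policy F :=
  if n is n'.+1 then fun k h =>
    if (size h < n')%N then greedy_upto n' k h else greedy_step (greedy_upto n') k h
  else fun _ _ => ord0.

Definition greedy_policy : policy F := fun k h => greedy_upto (size h).+1 k h.

Lemma greedy_uptoE n k h : (size h < n)%N -> greedy_upto n k h = greedy_policy k h.
Proof.
elim: n => // n IH; rewrite ltnS leq_eqVlt => /predU1P[hn|hn].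
  by rewrite -hn.
by rewrite -IH //= hn.
Qed.

(** Beliefs after [n] slots depend only on the first [n] decisions, so maximizing them is a sound
    recursion on [n]. *)
Lemma history_belief_local (A A' : policy F) (k n : nat) i :
  (forall k h, (size h < n)%N -> A k h = A' k h) ->
  history_belief A (k + n) k i = history_belief A' (k + n) k i.
Proof.
move=> AA'; apply/funext => h; congr cond_pr.
apply/seteqP; split => w /=; rewrite /info (schedule_local (n := n) w AA') //;
  by rewrite addKn.
Qed.

Lemma size_info (A : policy F) (k n : nat) (w : outcome N.+1 (k + n)) :
  size (info A w k) = n.
Proof. by rewrite info_schedule ?leq_addr// !size_map size_iota addKn. Qed.

Lemma greedy_policy_greedy : greedy M greedy_policy pi.
Proof.
move=> m k w /andP[_ km] i; move: w; rewrite -(subnKC km); move: (m - k)%N => n w.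
rewrite -[leLHS]/(history_belief greedy_policy (k + n) k i (info greedy_policy w k)).
rewrite -[leRHS]/(history_belief greedy_policy (k + n) k _ (info greedy_policy w k)).
have -> : decision greedy_policy w k =
    greedy_step (greedy_upto n) k (info greedy_policy w k).
  by rewrite /decision {1}/greedy_policy /= size_info ltnn.
rewrite /greedy_step size_info.
rewrite -!(@history_belief_local (greedy_upto n)); last 2 first.
- by move=> ? ?; exact: greedy_uptoE.
- by move=> ? ?; exact: greedy_uptoE.
by case: arg_maxP => // j _; apply.
Qed.

End GreedyExists.

Theorem proposition7 (R : realType) (M : downlink R)
    (hp : 0 <= pON M <= 1) (hr : 0 <= rON M <= 1) (hpr : rON M < pON M)
    (hpr2 : pON M + (1 - rON M) < 2) (hD : is_pmf (pD M)) :
  exists C : R,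
    [/\ is_sum_capacity M (arq 2) C,
        is_sum_capacity M (genie 2) C,
        series (fun l : nat =>
          (p_s M * iter l (Tmap M) (pON M) + (1 - p_s M) * p_s M)
          * pr (pD M) [set d | (d <= l)%N]
          * \prod_(0 <= d < l) pr (pD M) [set d' | (d < d')%N]) @ \oo --> C,
        exists A : policy (arq 2), greedy M A (pi_ss M (N := 2))
      & forall A : policy (arq 2), greedy M A (pi_ss M (N := 2)) ->
          has_rate M A C].
Proof.
have hpr' : 0 <= pON M - rON M < 1 by apply/andP; split; lra.
(* With two users [rev_ord a] is the other one; if [a] was OFF, it is the only user that can have
   been ON. *)
have arq_sel (a : 'I_2) (S : {ffun 'I_2 -> bool}) :
    S (if fb_map (arq 2) a S then a else rev_ord a) = [exists i, S i].
  case: ifPn => /= Sa; first by rewrite Sa; apply/esym/existsP; exists a.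
  case: (boolP (S (rev_ord a))) => Sb; apply/esym.
    by apply/existsP; exists (rev_ord a).
  apply/negbTE/existsPn => i.
  have [->//|ia] := eqVneq i a.
  suff -> : i = rev_ord a by [].
  apply/val_inj; case: a i ia {Sa Sb} => [[|[|//]] ?] [[|[|//]] ?] //.
have genie_sel (a : 'I_2) (S : {ffun 'I_2 -> bool}) :
    S (odflt a [pick i | fb_map (genie 2) a S i]) = [exists i, S i].
  case: pickP => /= [i Si|NS]; first by rewrite Si; apply/esym/existsP; exists i.
  by rewrite NS; apply/esym/negbTE/existsPn => i; rewrite NS.
set f := (fun l : nat => _).
have fE : f = fun l => lag_reward M 2 l * pr (pD M) [set d | (d <= l)%N]
          * \prod_(0 <= d < l) pr (pD M) [set d' | (d < d')%N].
  by apply/funext => l; rewrite lag_reward2.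
exists (limn (series f)); rewrite fE; split.
- split; last by move=> c [A]; exact: rate_le.
  exists (fun=> latest_rule (F := arq 2) (fun a b => if b then a else rev_ord a) ord0).
  exact: latest_rule_rate.
- split; last by move=> c [A]; exact: rate_le.
  exists (fun=> latest_rule (F := genie 2) (fun a S => odflt a [pick i | S i]) ord0).
  exact: latest_rule_rate.
- exact: is_cvg_gain.
(* This keeps the last clause from holding vacuously. *)
- exists (greedy_policy (F := arq 2) M (pi_ss M (N := 2))).
  exact: greedy_policy_greedy.
- move=> A; apply: (@greedy_rate _ _ _ _ _ _ (arq 2)
    (fun a b => if b then a else rev_ord a)) => //.
Qed.
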